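(* Let $0<s\le 1$ and let $(X,d,\mathcal{H}^s)$ be an $s$-Ahlfors regular metric space. If $u\in M^{1,s}(X,d,\mathcal{H}^s)$, then $u$ is uniformly continuous, in the sense that there is a uniformly continuous function $\tilde u:X\to\mathbb{R}$ with $\tilde u=u$ $\mathcal{H}^s$-almost everywhere. Moreover, there exists a constant $C>0$ such that for every ball $B=B(z,r)\subset X$ ($z\in X$, $r>0$) and every $g\in D(u)\cap L^s(X)$, $$\sup_{x,y\in B}|\tilde u(x)-\tilde u(y)|\le C\Big(\int_{2B} g^s\,d\mathcal{H}^s\Big)^{1/s},$$ where $2B=B(z,2r)$.
   Context: Let $(X,d)$ be a metric space, and let $B(x,r)=\{y\in X: d(x,y)<r\}$. $\mathcal{H}^s$ denotes the $s$-dimensional Hausdorff measure on $X$. For $s>0$ and a Borel measure $\mu$ on $X$, the space $(X,d,\mu)$ is called $s$-Ahlfors regular if there is a constant $C_A\ge 1$ such that $C_A^{-1}r^s\le \mu(B(x,r))\le C_A r^s$ for all $x\in X$ and all $0<r<\mathrm{diam}(X)$. Here $\mu=\mathcal{H}^s$. For a measurable function $u$ on $X$, $D(u)$ denotes the class of all nonnegative Borel functions $g$ on $X$ such that $|u(x)-u(y)|\le d(x,y)\,(g(x)+g(y))$ holds $\mu$-a.e., meaning that there is a set $E\subset X$ with $\mu(E)=0$ such that the inequality holds for all $x,y\in X\setminus E$. For $0<p<\infty$, the Hajłasz-Sobolev space $M^{1,p}(X,d,\mu)$ is the set of all (real-valued) $u\in L^p(X)$ such that $D(u)\cap L^p(X)\ne\emptyset$.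 In the claim, $p=s$ and $\mu=\mathcal{H}^s$. *)

(* Defs.v *)
From HB Require Import structures.
From mathcomp Require Import all_boot all_order all_algebra.
From mathcomp Require Import all_classical all_reals all_analysis.

Set Implicit Arguments.
Unset Strict Implicit.
Unset Printing Implicit Defensive.

Import Order.TTheory GRing.Theory Num.Theory.
Import numFieldTopology.Exports numFieldNormedType.Exports.

Local Open Scope classical_set_scope.
Local Open Scope ring_scope.
Local Open Scope ereal_scope.

(* Measurable types are pointed in the library, so the metric spaces considered
   here are nonempty. *)
#[short(type="pointedMetricType")]
HB.structure Definition PointedMetric (R : numDomainType) :=
  {M of Pointed M & Metric R M}.

Section hausdorff_measure.
Context {R : realType} {X : pointedMetricType R}.
Implicit Types (A : set X) (F : (set X)^nat) (s d : R).

(* The maximum with 0 gives diam set0 = 0 (the supremum alone is -oo). *)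
Definition diam A : \bar R :=
  maxe 0 (ereal_sup [set (mdist x y)%:E | x in A & y in A]).

(* The case distinction only matters for s = 0, where it makes the empty set
   contribute 0. *)
Definition diam_pow s A : \bar R := if A == set0 then 0 else diam A `^ s.

Definition hausdorff_pre s d A : \bar R :=
  ereal_inf [set \sum_(k <oo) diam_pow s (F k) |
    F in [set F : (set X)^nat |
            A `<=` \bigcup_k F k /\ forall k, diam (F k) <= d%:E]].

(* s-dimensional Hausdorff (outer) measure, without normalizing constant. *)
Definition hausdorff s A : \bar R :=
  ereal_sup [set hausdorff_pre s d A | d in [set d : R | (0 < d)%R]].

Lemma diam_ge0 A : 0 <= diam A.
Proof. by rewrite /diam le_max lexx. Qed.

Lemma diam_set0 : diam set0 = 0.
Proof.
rewrite /diam (_ : [set _ | _ in _ & _ in _] = set0) ?ereal_sup0 ?maxeNy//.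
by apply/seteqP; split => // ? [].
Qed.

Lemma diam_pow_ge0 s A : 0 <= diam_pow s A.
Proof. by rewrite /diam_pow; case: ifP => // _; exact: poweR_ge0. Qed.

Lemma diam_pow0 s : diam_pow s set0 = 0.
Proof. by rewrite /diam_pow eqxx. Qed.

Lemma hausdorff_pre_ge0 s d A : 0 <= hausdorff_pre s d A.
Proof.
apply: le_ereal_inf_tmp => _ [F _ <-].
by apply: nneseries_ge0 => n _ _; exact: diam_pow_ge0.
Qed.

Lemma hausdorff_pre0 s d : (0 < d)%R -> hausdorff_pre s d set0 = 0.
Proof.
move=> d0; apply/eqP; rewrite eq_le hausdorff_pre_ge0 andbT.
apply: ereal_inf_lbound; exists (fun=> set0) => /=.
  by split=> // k; rewrite diam_set0 lee_fin ltW.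
by apply: eseries0 => k _ _; rewrite diam_pow0.
Qed.

Lemma le_hausdorff_pre s d :
  {homo hausdorff_pre s d : A B / A `<=` B >-> A <= B}.
Proof.
move=> A B AB; apply: ereal_inf_le_tmp => _ [F [BF dF] <-].
by exists F => //; split => //; exact: subset_trans AB BF.
Qed.

Lemma hausdorff_pre_sigma_subadditive s d :
  sigma_subadditive (hausdorff_pre s d).
Proof.
move=> A; have [[i ioo]|] := pselect (exists i, hausdorff_pre s d (A i) = +oo).
  rewrite (eseries_pinfty _ _ ioo) ?leey// => n _.
  by rewrite -ltNye (lt_le_trans _ (hausdorff_pre_ge0 _ _ _)).
rewrite -forallNE => Aoo.
apply/lee_addgt0Pr => e e0.
rewrite (le_trans _ (epsilon_trick _ _ (ltW e0)))//; last first.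
  by move=> n; exact: hausdorff_pre_ge0.
pose P n F := (A n `<=` \bigcup_k F k /\ forall k, diam (F k) <= d%:E) /\
  \sum_(k <oo) diam_pow s (F k) <=
    hausdorff_pre s d (A n) + (e / (2 ^ n.+1)%:R)%:E.
have [G PG] : {G : ((set X)^nat)^nat & forall n, P n (G n)}.
  apply: (@choice _ _ P) => n; rewrite /P.
  have en1 : (0 < e / (2 ^ n.+1)%:R)%R by rewrite divr_gt0// ltr0n expn_gt0.
  have fA : hausdorff_pre s d (A n) \is a fin_num.
    by rewrite ge0_fin_numE ?hausdorff_pre_ge0// ltey; apply/eqP/Aoo.
  have [_ [F HF <-] lF] := lb_ereal_inf_adherent en1 fA.
  by exists F; split => //; exact: ltW.
have G_ge0 x : 0 <= (diam_pow s \o uncurry G) x by exact: diam_pow_ge0.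
apply: (@le_trans _ _ (\esum_(i in setT) (diam_pow s \o uncurry G) i)).
  apply: ereal_inf_lbound => /=.
  have /card_esym/ppcard_eqP[f] := card_nat2.
  exists (uncurry G \o f).
    split => [|k /=]; last first.
      by case: (f k) => i j; exact: (PG i).1.2.
    apply: (@subset_trans _ (\bigcup_n \bigcup_k G n k)) => [t [i _]|].
      by move=> /((PG i).1.1) -[j _ ?]; exists i => //; exists j.
    move=> t [i _ [j _ Bijt]]; exists (f^-1%FUN (i, j)) => //=.
    by rewrite invK ?inE.
  rewrite -(esum_pred_image (diam_pow s \o uncurry G) _ xpredT)
    ?[fun=> _]set_true//.
  by rewrite image_eq.
rewrite (_ : esum _ _ = \sum_(i <oo) \sum_(j <oo) diam_pow s (G i j));
    last first.
  pose J : nat -> set (nat * nat) := fun i => [set (i, j) | j in setT].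
  rewrite (_ : setT = \bigcup_k J k); last first.
    by rewrite predeqE => -[a b]; split => // _; exists a => //; exists b.
  rewrite esum_bigcupT /=; last 2 first.
    - apply/trivIsetP => i j _ _ ij.
      rewrite predeqE => -[n m] /=; split => //= -[] [_] _ [<-{n} _].
      by move=> [m' _] [] /esym/eqP; rewrite (negbTE ij).
    - by move=> /= x; exact: diam_pow_ge0.
  rewrite -(image_id [set: nat]) -fun_true esum_pred_image//; last first.
    by move=> n _; apply: esum_ge0 => ? _; exact: diam_pow_ge0.
  apply: eq_eseriesr => /= j _.
  rewrite -(esum_pred_image (diam_pow s \o uncurry G) (pair j) predT)/=;
      last 2 first.
    - by move=> k _; exact: diam_pow_ge0.
    - by move=> ? ? _ _; exact: (@can_inj _ _ _ snd).
  by congr esum; rewrite predeqE => -[a b]; split; move=> [i _ <-]; exists i.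
apply: lee_nneseries => n *; last exact: (PG n).2.
by apply: nneseries_ge0 => m *; exact: diam_pow_ge0.
Qed.

Lemma hausdorff_ge0 s A : 0 <= hausdorff s A.
Proof.
apply: (le_trans (hausdorff_pre_ge0 s 1 A)).
by apply: ereal_sup_ubound; exists 1%R => //=.
Qed.

Lemma hausdorff0 s : hausdorff s set0 = 0.
Proof.
apply/eqP; rewrite eq_le hausdorff_ge0 andbT.
by apply: ge_ereal_sup => _ [d /= d0 <-]; rewrite hausdorff_pre0.
Qed.

Lemma le_hausdorff s : {homo hausdorff s : A B / A `<=` B >-> A <= B}.
Proof.
move=> A B AB; apply: ge_ereal_sup => _ [d d0 <-].
apply: (le_trans (le_hausdorff_pre s d AB)).
by apply: ereal_sup_ubound; exists d.
Qed.

Lemma hausdorff_sigma_subadditive s : sigma_subadditive (hausdorff s).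
Proof.
move=> A; apply: ge_ereal_sup => _ [d d0 <-].
apply: (le_trans (hausdorff_pre_sigma_subadditive s d A)).
apply: lee_nneseries => n *; first exact: hausdorff_pre_ge0.
by apply: ereal_sup_ubound; exists d.
Qed.

HB.instance Definition _ s := isOuterMeasure.Build R X (hausdorff s)
  (hausdorff0 s) (hausdorff_ge0 s) (@le_hausdorff s)
  (@hausdorff_sigma_subadditive s).

End hausdorff_measure.

Section hajlasz.
Context {R : realType} {X : pointedMetricType R}.
Implicit Types (mu : {outer_measure set X -> \bar R}) (u g : X -> R) (p s : R).

(* The (complete) measure obtained by restricting an outer measure to its
   Caratheodory measurable sets. *)
Definition cara_measure mu : {measure set (caratheodory_type mu) -> \bar R} :=
  (mu : set (caratheodory_type mu) -> \bar R).

Definition ahlfors_regular s mu : Prop :=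
  exists2 CA : R, (1 <= CA)%R &
    forall (x : X) (r : R), (0 < r)%R -> r%:E < diam [set: X] ->
      (CA^-1 * r `^ s)%:E <= mu (ball x r) <= (CA * r `^ s)%:E.

Definition in_Lp mu p u : Prop :=
  measurable_fun [set: caratheodory_type mu] u /\
  finite_norm (cara_measure mu) p%:E u.

Definition borel_fun g : Prop :=
  measurable_fun [set: g_sigma_algebraType (@open X)] g.

(* Gradients are real-valued.  The exceptional set E is measurable because it is
   mu-null and cara_measure mu is complete. *)
Definition hajlasz_gradient mu u g : Prop :=
  [/\ forall x, (0 <= g x)%R,
      borel_fun g &
      exists2 E : set X, mu E = 0 &
        forall x y, ~ E x -> ~ E y ->
          (`|u x - u y| <= mdist x y * (g x + g y))%R].

Definition hajlasz_sobolev mu p u : Prop :=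
  in_Lp mu p u /\ exists2 g, hajlasz_gradient mu u g & in_Lp mu p g.

End hajlasz.

(* Main.v *)
Require Import Defs.
From mathcomp Require Import all_boot all_order all_algebra.
From mathcomp Require Import all_classical all_reals all_analysis.
From mathcomp Require Import measurable_realfun ring lra.
Import Order.TTheory GRing.Theory Num.Theory.
Import numFieldTopology.Exports numFieldNormedType.Exports.
Local Open Scope classical_set_scope.
Local Open Scope ring_scope.
Local Open Scope ereal_scope.

Set Implicit Arguments.
Unset Strict Implicit.
Unset Printing Implicit Defensive.

(** The claim rests on chaining through concentric shells.  Fix a gradient
    [g] of [u] with null exceptional set [E].  Regularity gives a ratio
    [lambda < 1] for which every shell
    [B(x, t) \ B(x, lambda t)] has measure comparable to [t^s]
    ([shell_measure_ge]).  Such a shell contains a point off [E] where [g^s]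
    does not exceed its average over the shell, that is, a point [y] with
    [t g(y) <= c a^(1/s)] where [a] is the integral of [g^s] over the shell
    ([exists_shell_point]).  For [x] off [E], take such points [y_k] in the
    shells of radii [lambda^k r].  The gradient inequality bounds
    [|u(y_k) - u(y_(k+1))|] by a multiple of
    [a_k^(1/s) + a_(k+1)^(1/s)].  Since the shells are disjoint and
    [1/s >= 1], [\sum a_k^(1/s) <= (\sum a_k)^(1/s)], which is at most the
    [1/s] power of the integral of [g^s] over [B(x, r)]; and
    [u(y_k)] tends to [u(x)] because [|u(x) - u(y_k)|] is at most
    [lambda^k r (g(x) + g(y_k))].  This is [osc_center].  Working with
    disjoint shells rather than with nested balls is essential: for balls
    the corresponding series may diverge.

    Joining the chains of two points of [B(z, r)] gives the oscillation
    estimate off [E] ([osc_off_null]).  As the integral of [g^s] over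
    [B(x, t)] tends to 0 with [t], uniformly in [x], by absolute
    continuity of the integral, [u] is uniformly continuous off [E]; null sets
    have dense complement, so [u] extends to a uniformly continuous function
    [ut].  The estimate for another gradient holds off the union of the two
    exceptional sets and passes to [ut] by density ([dense_osc_le]).

    Integrating over balls and shells requires them to be measurable for the
    Hausdorff measure.  This is Caratheodory's criterion
    ([metric_outer_measure_sublevel]), applicable because Hausdorff measure is
    additive on sets at positive distance
    ([hausdorff_metric_outer_measure]). *)

(** * Additivity of Hausdorff measure on separated sets *)

Definition separated_by {R : realType} {X : metricType R} (eta : R)
    (A B : set X) :=
  forall a b, A a -> B b -> (eta <= mdist a b)%R.

Definition metric_outer_measure {R : realType} {X : metricType R}
    (mu : set X -> \bar R) :=
  forall (eta : R) (A B : set X), (0 < eta)%R -> separated_by eta A B ->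
    mu A + mu B <= mu (A `|` B).

Section hausdorff_metric.
Context {R : realType} {X : pointedMetricType R}.
Implicit Types (A B : set X) (s d eta : R).

Lemma mdist_le_diam A x y : A x -> A y -> (mdist x y)%:E <= diam A.
Proof.
move=> Ax Ay; rewrite /diam le_max; apply/orP; right.
by apply: ereal_sup_ubound; exists x => //; exists y.
Qed.

(** A covering set of diameter at most [d < eta] cannot meet both [A] and [B],
    so every covering of the union splits into a covering of [A] and one of
    [B]. *)
Lemma hausdorff_pre_separated s d eta A B : (d < eta)%R ->
  separated_by eta A B ->
  hausdorff_pre s d A + hausdorff_pre s d B <= hausdorff_pre s d (A `|` B).
Proof.
move=> deta AB; apply: le_ereal_inf_tmp => _ [F [ABF dF] <-].
pose G k := if `[< F k `&` A !=set0 >] then F k else set0.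
pose H k := if `[< F k `&` A !=set0 >] then set0 else F k.
have -> : \sum_(k <oo) diam_pow s (F k) =
    \sum_(k <oo) diam_pow s (G k) + \sum_(k <oo) diam_pow s (H k).
  rewrite -nneseriesD; [|by move=> *; exact: diam_pow_ge0..].
  apply: eq_eseriesr => k _; rewrite /G /H.
  by case: ifP; rewrite diam_pow0 ?adde0 ?add0e.
have small C k : (C = F k \/ C = set0) -> diam C <= d%:E.
  case=> ->; first exact: dF.
  by rewrite diam_set0; apply: (le_trans (diam_ge0 _) (dF k)).
apply: leeD; apply: ereal_inf_lbound => /=.
- exists G => //; split => [a Aa|k]; last first.
    by apply: small; rewrite /G; case: ifP; [left|right].
  have [k _ Fka] := ABF a (or_introl Aa); exists k => //.
  by rewrite /G asboolT//; exists a.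
- exists H => //; split => [b Bb|k]; last first.
    by apply: small; rewrite /H; case: ifP; [right|left].
  have [k _ Fkb] := ABF b (or_intror Bb); exists k => //.
  rewrite /H asboolF// => -[a [Fka Aa]].
  have := le_trans (mdist_le_diam Fka Fkb) (dF k).
  by rewrite lee_fin leNgt (lt_le_trans deta (AB _ _ Aa Bb)).
Qed.

Lemma hausdorff_pre_antitone s A d d' : (d <= d')%R ->
  hausdorff_pre s d' A <= hausdorff_pre s d A.
Proof.
move=> dd'; apply: ereal_inf_le_tmp => _ [F [AF dF] <-]; exists F => //.
by split => // k; rewrite (le_trans (dF k))// lee_fin.
Qed.

(** The suprema over the scales for [A] and for [B] are independent; since the
    premeasures grow as the scale shrinks, both scales may be lowered to a
    common one below [eta]. *)
Lemma hausdorff_metric_outer_measure s :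
  metric_outer_measure (hausdorff s : set X -> \bar R).
Proof.
move=> eta A B eta0 AB.
have [->|Woo] := eqVneq (hausdorff s (A `|` B)) +oo; first by rewrite leey.
have common d d' : (0 < d)%R -> (0 < d')%R ->
    hausdorff_pre s d A + hausdorff_pre s d' B <= hausdorff s (A `|` B).
  move=> d0 d'0; pose e := Num.min (Num.min d d') (eta / 2)%R.
  have e0 : (0 < e)%R by rewrite !lt_min d0 d'0 divr_gt0.
  have ed : (e <= d)%R by rewrite !ge_min lexx.
  have ed' : (e <= d')%R by rewrite !ge_min lexx orbT.
  have eeta : (e < eta)%R.
    by rewrite gt_min (_ : eta / 2 < eta)%R ?orbT//; lra.
  apply: (le_trans (leeD (hausdorff_pre_antitone s A ed)
    (hausdorff_pre_antitone s B ed'))).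
  apply: (le_trans (hausdorff_pre_separated s eeta AB)).
  by apply: ereal_sup_ubound; exists e.
have pre_le d (D : set X) : (0 < d)%R -> hausdorff_pre s d D <= hausdorff s D.
  by move=> d0; apply: ereal_sup_ubound; exists d.
have finB : hausdorff s B \is a fin_num.
  rewrite ge0_fin_numE ?hausdorff_ge0// (@le_lt_trans _ _
    (hausdorff s (A `|` B))) ?ltey//.
  exact/le_hausdorff/subsetUr.
rewrite -leeBrDr//; apply: ge_ereal_sup => _ [d /= d0 <-]; rewrite leeBrDr//.
have finA : hausdorff_pre s d A \is a fin_num.
  rewrite ge0_fin_numE ?hausdorff_pre_ge0// (@le_lt_trans _ _
    (hausdorff s (A `|` B))) ?ltey//.
  by apply: (le_trans (pre_le d A d0)); exact/le_hausdorff/subsetUl.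
rewrite addeC -leeBrDr//; apply: ge_ereal_sup => _ [d' /= d'0 <-].
by rewrite leeBrDr// addeC; exact: common.
Qed.

End hausdorff_metric.

(** * Caratheodory's criterion *)

(** Suppose that [mu A] is finite and let [r n] increase to [t].  The part [L n]
    of [A] where [f < r n] is separated from the part where [t <= f], so it
    suffices that what lies between has measure tending to 0.  It is cut into
    slices [D k], [k >= n], whose measures form a convergent series: [L n] is
    separated from [D n.+1], which by induction bounds the partial sums by
    [mu (L n.+1) + mu (L n) <= 2 mu A]. *)
Lemma metric_outer_measure_sublevel (R : realType) (X : metricType R)
    (mu : {outer_measure set X -> \bar R})
    (f : X -> R) (t : R) :
  metric_outer_measure mu ->
  (forall y z, (f z - f y <= mdist y z)%R) ->
  mu.-caratheodory [set y | (f y < t)%R].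
Proof.
move=> mumet lip; apply: le_caratheodory_measurable => A.
have [muAoo|muAfin] := eqVneq (mu A) +oo; first by rewrite muAoo leey.
have tri (B C D : set X) (a b : R) : (a < b)%R ->
    B `<=` A `&` [set y | (f y < a)%R] -> C `<=` A `&` [set y | (b <= f y)%R] ->
    B `|` C `<=` D -> mu B + mu C <= mu D.
  move=> ab BA CA BCD; apply: (le_trans _ (le_outer_measure mu _ _ BCD)).
  apply: (mumet (b - a)%R); first by rewrite subr_gt0.
  move=> y z /BA[_ /= fy] /CA[_ /= fz].
  by apply: le_trans (lip y z); rewrite lerB// ltW.
pose r (n : nat) : R := (t - n.+1%:R^-1)%R.
have r_lt n : (r n < r n.+1)%R.
  by rewrite ltrD2l ltrN2 ltf_pV2 ?posrE// ltr_nat.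
have rt n : (r n < t)%R by rewrite ltrBlDr ltrDl invr_gt0.
pose L n := A `&` [set y | (f y < r n)%R].
pose D n := A `&` [set y | (r n <= f y < r n.+1)%R].
have sumD n : \sum_(0 <= k < n.+1) mu (D k) <= mu (L n.+1) + mu (L n).
  elim: n => [|n IH].
    rewrite big_nat1; apply: (@le_trans _ _ (mu (L 1%N))).
      by apply: le_outer_measure => y [Ay /andP[_ ?]]; split.
    by rewrite leeDl// outer_measure_ge0.
  rewrite big_nat_recr//=; apply: (le_trans (leeD2r _ IH)).
  rewrite -addeA [X in _ <= X]addeC leeD2l//.
  apply: (@tri _ _ _ (r n) (r n.+1)) => //.
    by move=> y [Ay /andP[]].
  move=> y [[Ay /= fy]|[Ay /andP[_ ?]]]; split => //=.
  by rewrite (lt_trans fy)// (lt_trans (r_lt _)).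
have LA n : mu (L n) <= mu A by apply: le_outer_measure => y [].
have muAlt : mu A < +oo by rewrite ltey.
have sumD_fin : \sum_(0 <= k <oo) mu (D k) < +oo.
  apply: (@le_lt_trans _ _ (mu A + mu A)); last by rewrite lte_add_pinfty.
  apply: lime_le.
    by apply: is_cvg_nneseries => k _ _; exact: outer_measure_ge0.
  near=> n.
  apply: (@le_trans _ _ (\sum_(0 <= k < n.+1) mu (D k))).
    by rewrite big_nat_recr//= leeDl// outer_measure_ge0.
  by apply: (le_trans (sumD _)); apply: leeD.
have tail := nneseries_tail_cvg sumD_fin (fun k _ => outer_measure_ge0 mu (D k)).
have bnd n : mu (A `&` [set y | (f y < t)%R]) +
    mu (A `&` ~` [set y | (f y < t)%R]) <= mu A + \sum_(n <= k <oo) mu (D k).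
  have cover : A `&` [set y | (f y < t)%R] `<=`
      L n `|` \bigcup_k D (k + n)%N.
    move=> y [Ay /= fyt].
    have [fyr|fyr] := ltP (f y) (r n); first by left.
    right.
    have ex : exists m, (f y < r m)%R.
      have d0 : (0 < t - f y)%R by rewrite subr_gt0.
      exists (Num.truncn (t - f y)^-1).
      rewrite ltrBrDl -ltrBrDr invf_plt ?posrE//.
      exact: truncnS_gt.
    case: (ex_minnP ex) => -[|m] fym min_m.
      have r0n : (r 0%N <= r n)%R.
        by rewrite lerD2l lerN2 lef_pV2 ?posrE// ler_nat.
      by have := lt_le_trans fym (le_trans r0n fyr); rewrite ltxx.
    have rmf : (r m <= f y)%R.
      by rewrite leNgt; apply/negP => /min_m; rewrite ltnn.
    have nm : (n <= m)%N.
      rewrite leqNgt; apply/negP => mn.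
      have rle : (r m.+1 <= r n)%R.
        by rewrite lerD2l lerN2 lef_pV2 ?posrE// ler_nat.
      by have := lt_le_trans fym (le_trans rle fyr); rewrite ltxx.
    by exists (m - n)%N => //; rewrite subnK//; split => //=; rewrite rmf.
  apply: (le_trans (leeD2r _ (le_outer_measure mu _ _ cover))).
  apply: (le_trans (leeD2r _ (outer_measureU2 mu _ _))).
  rewrite addeAC; apply: leeD.
    apply: (@tri _ _ _ (r n) t) => //.
      by move=> y [Ay /= /negP]; rewrite -leNgt.
    by move=> y [[]|[]].
  apply: (le_trans (outer_measure_sigma_subadditive mu _)).
  rewrite -(@nneseries_addn _ (mu \o D)) ?addn0//.
  by move=> k; exact: outer_measure_ge0.
have cvgA : mu A + \sum_(n <= k <oo) mu (D k) @[n --> \oo] --> mu A + 0.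
  by apply: cvgeD => //; [rewrite fin_num_adde_defl|exact: cvg_cst].
rewrite -[leRHS]adde0 -(cvg_lim _ cvgA)//; apply: lime_ge.
  by apply/cvg_ex; eexists; exact: cvgA.
exact: nearW.
Unshelve. all: by end_near. Qed.

Lemma ball_cara_measurable (R : realType) (X : pointedMetricType R)
    (mu : {outer_measure set X -> \bar R}) (x : X) (r : R) :
  metric_outer_measure mu ->
  measurable (ball x r : set (caratheodory_type mu)).
Proof.
move=> mumet; rewrite ballEmdist.
apply: (@metric_outer_measure_sublevel _ _ mu (mdist x)) => // y z.
by rewrite lerBlDl metric_triangle.
Qed.

(** * Sums of powers, chains and averages *)

(** With [S] the sum, [a^q = a a^(q-1) <= a S^(q-1)].  For [q = 1/s] this is
    where the assumption [s <= 1] enters. *)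
Lemma sum_powR_le (R : realType) (q : R) (a : nat -> R) (n : nat) :
  (1 <= q)%R -> (forall k, (0 <= a k)%R) ->
  (\sum_(k < n) a k `^ q <= (\sum_(k < n) a k) `^ q)%R.
Proof.
move=> q1 a0; set S := (\sum_(k < n) a k)%R.
have [S0|S0] := eqVneq S 0%R.
  rewrite big1 ?powR_ge0// => k _.
  have /eqP : S == 0%R by rewrite S0.
  rewrite /S => /psumr_eq0P -> //.
  by rewrite powR0// gt_eqF// (lt_le_trans ltr01).
have Sgt0 : (0 < S)%R by rewrite lt_neqAle eq_sym S0 sumr_ge0.
have split_pow (b : R) : (0 <= b)%R -> (b `^ q = b * b `^ (q - 1))%R.
  move=> b0; rewrite -{2}(powRr1 b0) -powRD.
    by rewrite addrC subrK.
  by rewrite addrC subrK gt_eqF// (lt_le_trans ltr01).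
rewrite split_pow ?sumr_ge0// mulr_suml; apply: ler_sum => k _.
rewrite split_pow//; apply: ler_wpM2l => //.
apply: ge0_ler_powR; rewrite ?subr_ge0 ?nnegrE ?sumr_ge0//.
by rewrite /S (bigD1 k)//= lerDl sumr_ge0.
Qed.

(** Otherwise [f - c] would be positive almost everywhere on [S] with integral
    at most 0. *)
Lemma exists_le_average d (T : measurableType d) (R : realType)
    (mu : {measure set T -> \bar R}) (S N : set T) (f : T -> R) (m c : R) :
  measurable S -> measurable_fun S f -> (forall x, S x -> (0 <= f x)%R) ->
  measurable N -> mu N = 0 -> (0 < m)%R -> m%:E <= mu S ->
  \int[mu]_(x in S) (f x)%:E <= (m * c)%:E ->
  exists x, [/\ S x, ~ N x & (f x <= c)%R].
Proof.
move=> mS mf f0 mN N0 m0 mS_ge intf; apply: contrapT => no.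
have fc x : S x -> ~ N x -> (c < f x)%R.
  by move=> Sx Nx; rewrite ltNge; apply/negP => fxc; apply: no; exists x.
have c0 : (0 <= c)%R.
  rewrite -(pmulr_rge0 _ m0) -lee_fin; apply: le_trans intf.
  by apply: integral_ge0 => x Sx; rewrite lee_fin f0.
pose S' := S `\` N.
have mS' : measurable S' by exact: measurableD.
have S'S : S' `<=` S by move=> x [].
have muS' : m%:E <= mu S'.
  apply: (le_trans mS_ge); rewrite -[leRHS]adde0 -N0.
  apply: (le_trans _ (measureU2 _ _ _)) => //.
  apply: le_measure; rewrite ?inE//; first exact: measurableU.
  by move=> x Sx; have [Nx|Nx] := pselect (N x); [right|left].
have mf' : measurable_fun S' f by exact: measurable_funS mf.
pose h x := (f x - c)%R.
have mh : measurable_fun S' h by exact: measurable_funB.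
have h0 x : S' x -> 0 <= (h x)%:E.
  by move=> [Sx Nx]; rewrite lee_fin subr_ge0 ltW// fc.
have int_h : \int[mu]_(x in S') (h x)%:E = 0.
  apply/eqP; rewrite eq_le integral_ge0 ?andbT//.
  have : \int[mu]_(x in S') (h x)%:E + (m * c)%:E <= (m * c)%:E.
    apply: le_trans intf.
    apply: (@le_trans _ _ (\int[mu]_(x in S') (f x)%:E)); last first.
      by apply: ge0_subset_integral => //; exact/measurable_EFinP.
    have -> : \int[mu]_(x in S') (f x)%:E =
        \int[mu]_(x in S') ((h x)%:E + c%:E).
      by apply: eq_integral => x _; rewrite -EFinD subrK.
    rewrite (@ge0_integralD _ _ _ mu S' mS' (EFin \o h) (cst c%:E))//;
      last exact/measurable_EFinP.
    rewrite leeD2l// integral_cst// mulrC EFinM.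
    by apply: lee_wpmul2l => //; rewrite lee_fin.
  by rewrite -leeBrDr// subee.
have /ae_eq_integral_abs : measurable_fun S' (EFin \o h) by exact/measurable_EFinP.
move=> /(_ mu mS')[+ _].
have -> : \int[mu]_(x in S') `|(EFin \o h) x| = 0.
  rewrite -[RHS]int_h; apply: eq_integral => x /set_mem S'x.
  by rewrite gee0_abs// h0.
move=> /(_ erefl) [Z [mZ Z0 hZ]].
have S'Z : S' `<=` Z.
  move=> x S'x; apply: hZ => /(_ S'x) /= [].
  by apply/eqP; rewrite subr_eq0 gt_eqF// fc//; case: S'x.
have : mu S' <= mu Z by apply: le_measure; rewrite ?inE.
by rewrite Z0 => /(le_trans muS'); rewrite lee_fin leNgt m0.
Qed.

Lemma chain_bound (R : realDomainType) (v b : nat -> R) (a c B : R) n :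
  (0 <= a)%R -> (0 <= c)%R ->
  (forall k, `|v k - v k.+1| <= a * b k + c * b k.+1)%R ->
  (forall k, \sum_(i < k) b i <= B)%R -> (forall k, 0 <= b k)%R ->
  (`|v 0%N - v n| <= (a + c) * B)%R.
Proof.
move=> a0 c0 step sumb b0.
have tele : (`|v 0%N - v n| <=
    a * (\sum_(k < n) b k) + c * (\sum_(k < n) b k.+1))%R.
  elim: n => [|n IH]; first by rewrite subrr normr0 !big_ord0 !mulr0 addr0.
  rewrite 2!big_ord_recr /= 2!mulrDr addrACA.
  apply: le_trans (lerD IH (step n)).
  by rewrite -(subrKA (v n)) ler_normD.
apply: (le_trans tele); rewrite mulrDl.
apply: lerD; apply: ler_wpM2l => //.
by apply: le_trans (sumb n.+1); rewrite big_ord_recl/= lerDr.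
Qed.

(** * Shells in Ahlfors regular spaces *)

Section ahlfors.
Context {R : realType} {X : pointedMetricType R}.
Context (mu : {outer_measure set X -> \bar R}) (s C : R).

(** The solution [lambda] of [C (lambda r)^s = (2 C)^-1 r^s]: the upper bound
    for the measure of the inner ball is half of the lower bound for that of
    the outer one. *)
Definition shell_ratio : R := ((2 * C ^+ 2)^-1 `^ s^-1)%R.

Definition shell (x : X) (r : R) : set X :=
  ball x r `\` ball x (shell_ratio * r)%R.

Context (mumet : metric_outer_measure mu) (s0 : (0 < s)%R) (C1 : (1 <= C)%R).
Context (reg : forall (x : X) (r : R), (0 < r)%R -> r%:E < diam [set: X] ->
  (C^-1 * r `^ s)%:E <= mu (ball x r) <= (C * r `^ s)%:E).

Let C0 : (0 < C)%R. Proof. by apply: lt_le_trans C1. Qed.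

Lemma shell_ratio_gt0 : (0 < shell_ratio)%R.
Proof. by rewrite powR_gt0// invr_gt0 mulr_gt0// exprn_gt0. Qed.

Lemma shell_ratio_lt1 : (shell_ratio < 1)%R.
Proof.
have s'0 : (0 < s^-1)%R by rewrite invr_gt0.
have -> : (1 = (1 : R) `^ s^-1)%R by rewrite powR1.
apply: gt0_ltr_powR; rewrite ?nnegrE ?invr_ge0 ?mulr_ge0 ?exprn_ge0 ?(ltW C0)//.
rewrite invf_lt1 ?mulr_gt0 ?exprn_gt0//.
have := exprn_ege1 2 C1; lra.
Qed.

Lemma shell_measure_ge x r : (0 < r)%R -> r%:E < diam [set: X] ->
  ((2 * C)^-1 * r `^ s)%:E <= mu (shell x r).
Proof.
move=> r0 rX; have l0 := shell_ratio_gt0; have l1 := shell_ratio_lt1.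
have lr0 : (0 < shell_ratio * r)%R by rewrite mulr_gt0.
have lrr : (shell_ratio * r < r)%R by rewrite gtr_pMl.
have /andP[lo _] := reg x r0 rX.
have /andP[_ up] := reg x lr0 (lt_trans (lrr : _%:E < _%:E) rX).
have cov : mu (ball x r) <= mu (shell x r) + mu (ball x (shell_ratio * r)%R).
  apply: (le_trans _ (outer_measureU2 mu _ _)); apply: le_outer_measure => y xy.
  by have [?|?] := pselect (ball x (shell_ratio * r) y); [right|left].
have {cov}: (C^-1 * r `^ s)%:E <=
    mu (shell x r) + (C * (shell_ratio * r) `^ s)%:E.
  by apply: (le_trans lo); apply: (le_trans cov); exact: leeD2l.
rewrite -leeBlDr// -EFinB.
suff -> : (C^-1 * r `^ s - C * (shell_ratio * r) `^ s = (2 * C)^-1 * r `^ s)%R by [].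
rewrite powRM ?(ltW l0) ?(ltW r0)// /shell_ratio -powRrM mulVf ?gt_eqF// powRr1; last first.
  by rewrite invr_ge0 mulr_ge0 ?exprn_ge0 ?(ltW C0).
by field; rewrite gt_eqF.
Qed.

Context (X0 : 0 < diam [set: X]).

Lemma exists_radius : exists2 r : R, (0 < r)%R & r%:E < diam [set: X].
Proof.
move: X0; case: (diam _) => [D| |]//; first rewrite lte_fin => D0.
  by exists (D / 2)%R; rewrite ?divr_gt0// lte_fin; lra.
by move=> _; exists 1%R => //; exact: ltry.
Qed.

Lemma off_null_dense (N : set X) : mu N = 0 ->
  forall (x : X) (e : R), (0 < e)%R -> exists2 y, (mdist x y < e)%R & ~ N y.
Proof.
move=> N0 x e e0; have [r r0 rX] := exists_radius.
have me0 : (0 < Num.min e r)%R by rewrite lt_min e0.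
have meX : (Num.min e r)%:E < diam [set: X].
  by apply: le_lt_trans rX; rewrite lee_fin ge_min lexx orbT.
apply: contrapT => no.
have /andP[+ _] := reg x me0 meX; apply/negP; rewrite -ltNge.
apply: (@le_lt_trans _ _ (mu N)); last first.
  by rewrite N0 lte_fin mulr_gt0 ?invr_gt0 ?powR_gt0.
apply: le_outer_measure => y; rewrite ballEmdist/= lt_min => /andP[xy _].
by apply: contrapT => Ny; apply: no; exists y.
Qed.

(** For [r] smaller than the diameter take [rho = r].  For larger [r] the
    regularity bounds are not available at scale [r], but then the space is
    bounded and half of its diameter will do. *)
Lemma exists_comparable_radius (x y z : X) r : (0 < r)%R ->
  (mdist z x < r)%R -> (mdist z y < r)%R ->
  exists rho : R, [/\ (0 < rho)%R, rho%:E < diam [set: X], (rho <= r)%R &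
    forall a b, (mdist x a < rho)%R -> (mdist y b < rho)%R ->
      (mdist a b <= 4 * rho)%R].
Proof.
move=> r0 zx zy; have [rX|Xr] := ltP r%:E (diam [set: X]).
  exists r; split => // a b xa yb.
  have := metric_triangle a x b; have := metric_triangle x z b.
  have := metric_triangle z y b; rewrite (metric_sym a x) (metric_sym x z).
  by move: xa yb zx zy; lra.
have [D DX] : exists D : R, diam [set: X] = D%:E.
  exists (fine (diam [set: X])); rewrite fineK//.
  by rewrite ge0_fin_numE ?diam_ge0// (le_lt_trans Xr)// ltry.
have D0 : (0 < D)%R by move: X0; rewrite DX.
have Dr : (D <= r)%R by move: Xr; rewrite DX.
exists (D / 2)%R; rewrite DX lte_fin; split; [by lra|by lra|by lra|].
move=> a b _ _; have := @mdist_le_diam _ X setT a b I I.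
by rewrite DX lee_fin; lra.
Qed.

(** * Chaining through shells *)

Context (s1 : (s <= 1)%R) (u g : X -> R) (E : set X).
Context (g0 : forall x, (0 <= g x)%R) (E0 : mu E = 0).
Context (ug : forall x y, ~ E x -> ~ E y ->
  (`|u x - u y| <= mdist x y * (g x + g y))%R).
Context (ig : (cara_measure mu).-integrable setT
  (EFin \o (fun x => g x `^ s)%R)).

Definition energy (A : set X) : R :=
  (\int[cara_measure mu]_(x in A) (g x `^ s))%R.

(** The [1/s] power of the inverse of the constant in [shell_measure_ge]. *)
Definition shell_const : R := ((2 * C) `^ s^-1)%R.

Let is0 : (0 < s^-1)%R. Proof. by rewrite invr_gt0. Qed.

Lemma energy_ge0 A : (0 <= energy A)%R.
Proof. by apply: Rintegral_ge0 => x _; exact: powR_ge0. Qed.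

Lemma integrable_on (A : set (caratheodory_type mu)) : measurable A ->
  (cara_measure mu).-integrable A (EFin \o (fun x => g x `^ s)%R).
Proof. by move=> mA; apply: (integrableS measurableT). Qed.

Lemma energyE (A : set (caratheodory_type mu)) : measurable A ->
  \int[cara_measure mu]_(x in A) (g x `^ s)%:E = (energy A)%:E.
Proof.
move=> mA; rewrite /energy /Rintegral fineK//.
by apply: integrable_fin_num => //; exact: integrable_on.
Qed.

Lemma energyS (A B : set (caratheodory_type mu)) : measurable A ->
  measurable B -> A `<=` B -> (energy A <= energy B)%R.
Proof.
move=> mA mB AB; rewrite -lee_fin -!energyE//.
apply: ge0_subset_integral => //; first exact: measurable_int (integrable_on mB).
by move=> x _; rewrite lee_fin powR_ge0.
Qed.

Lemma shell_measurable x r : measurable (shell x r : set (caratheodory_type mu)).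
Proof. by apply: measurableD; exact: ball_cara_measurable. Qed.

Lemma null_measurable : measurable (E : set (caratheodory_type mu)).
Proof.
apply: le_caratheodory_measurable => A.
have -> : mu (A `&` E) = 0.
  apply/eqP; rewrite eq_le outer_measure_ge0 andbT -E0.
  by apply: le_outer_measure => y [].
by rewrite add0e; apply: le_outer_measure => y [].
Qed.

(** On average over the shell, [r^s g^s] is at most [2 C] times the energy of
    the shell. *)
Lemma exists_shell_point x r : (0 < r)%R -> r%:E < diam [set: X] ->
  exists y, [/\ (mdist x y < r)%R, ~ E y &
    (r * g y <= shell_const * energy (shell x r) `^ s^-1)%R].
Proof.
move=> r0 rX; have mS := shell_measurable x r.
have rs0 : (0 < r `^ s)%R by rewrite powR_gt0.
have [| | |y [[xy _] Ey gy]] := @exists_le_average _ _ _ (cara_measure mu)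
  (shell x r) E (fun y => g y `^ s)%R ((2 * C)^-1 * r `^ s)%R
  ((2 * C) * energy (shell x r) / r `^ s)%R mS _
  (fun y _ => powR_ge0 _ _) null_measurable E0 _ (shell_measure_ge x r0 rX).
- by apply/measurable_EFinP; exact: measurable_int (integrable_on mS).
- by rewrite mulr_gt0// invr_gt0 mulr_gt0.
- rewrite energyE// lee_fin le_eqVlt; apply/orP; left; apply/eqP; field.
  by rewrite !gt_eqF.
move: xy; rewrite ballEmdist/= => xy; exists y; split => //.
rewrite /shell_const -powRM ?energy_ge0 ?mulr_ge0 ?(ltW C0)//.
have rg0 : (0 <= r * g y)%R by rewrite mulr_ge0 ?(ltW r0).
have -> : (r * g y = ((r * g y) `^ s) `^ s^-1)%R.
  by rewrite -powRrM mulfV ?gt_eqF// powRr1.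
apply: ge0_ler_powR; rewrite ?nnegrE ?powR_ge0 ?(ltW is0) ?mulr_ge0 ?energy_ge0 ?(ltW C0)//.
by rewrite powRM ?(ltW r0)// mulrC -ler_pdivlMr ?powR_gt0.
Qed.

Let rad (r : R) (k : nat) : R := (shell_ratio ^+ k * r)%R.

Lemma rad_gt0 r n : (0 < r)%R -> (0 < rad r n)%R.
Proof. by move=> r0; rewrite mulr_gt0// exprn_gt0// shell_ratio_gt0. Qed.

Lemma radS r n : rad r n.+1 = (shell_ratio * rad r n)%R.
Proof. by rewrite /rad exprS mulrA. Qed.

Lemma rad_le r n : (0 < r)%R -> (rad r n <= r)%R.
Proof.
move=> r0; rewrite /rad ler_piMl ?(ltW r0)// exprn_ile1//.
  exact: ltW shell_ratio_gt0.
exact: ltW shell_ratio_lt1.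
Qed.

Lemma sum_shell_energy x r n : (0 < r)%R ->
  (\sum_(k < n) energy (shell x (rad r k)) + energy (ball x (rad r n)) =
   energy (ball x r))%R.
Proof.
move=> r0; elim: n => [|n IH]; first by rewrite big_ord0 add0r /rad expr0 mul1r.
rewrite big_ord_recr/= -IH -addrA; congr (_ + _)%R; rewrite radS.
have mB := @ball_cara_measurable _ _ mu x (shell_ratio * rad r n) mumet.
have mS := shell_measurable x (rad r n).
have -> : ball x (rad r n) =
    shell x (rad r n) `|` ball x (shell_ratio * rad r n)%R.
  rewrite /shell setUC setDUK//; apply: le_ball.
  by rewrite ler_piMl ?(ltW (rad_gt0 _ _))// (ltW shell_ratio_lt1).
rewrite /energy -Rintegral_setU//.
- by apply: integrable_on; exact: measurableU.
- by apply/disj_set2P; rewrite /shell setIC setDIK.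
Qed.

(** Consecutive points [y_k], [y_(k+1)] of a chain are at distance at most
    [2 r_k], and [r_k = r_(k+1) / shell_ratio]; this gives [2] for [g(y_k)]
    and [2 / shell_ratio] for [g(y_(k+1))].  The remaining unit pays for the
    step from the last point of the chain to its limit. *)
Definition chain_const : R := ((3 + 2 / shell_ratio) * shell_const)%R.

(** The point [y] starts a chain with one point in each of the successive shells
    around [x], along which [u] varies in a controlled way and tends to
    [u(x)]. *)
Lemma osc_center x r : ~ E x -> (0 < r)%R -> r%:E < diam [set: X] ->
  exists y, [/\ (mdist x y < r)%R, ~ E y,
    (r * g y <= shell_const * energy (ball x r) `^ s^-1)%R &
    (`|u x - u y| <= chain_const * energy (ball x r) `^ s^-1)%R].
Proof.
move=> Ex r0 rX; have l0 := shell_ratio_gt0; have l1 := shell_ratio_lt1.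
have /choice[y yP] : forall k, exists y, [/\ (mdist x y < rad r k)%R, ~ E y &
    (rad r k * g y <= shell_const * energy (shell x (rad r k)) `^ s^-1)%R].
  move=> k; apply: exists_shell_point; first exact: rad_gt0.
  by apply: le_lt_trans rX; rewrite lee_fin rad_le.
pose b k := (shell_const * energy (shell x (rad r k)) `^ s^-1)%R.
pose B := (shell_const * energy (ball x r) `^ s^-1)%R.
have K0 : (0 <= shell_const)%R by exact: powR_ge0.
have b0 k : (0 <= b k)%R by rewrite mulr_ge0// powR_ge0.
have sumb n : (\sum_(k < n) b k <= B)%R.
  rewrite -mulr_sumr ler_wpM2l//.
  apply: (@le_trans _ _ ((\sum_(k < n) energy (shell x (rad r k))) `^ s^-1)%R).
    apply: (@sum_powR_le _ _ (fun k => energy (shell x (rad r k)))).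
      by rewrite invf_ge1.
    by move=> k; exact: energy_ge0.
  apply: ge0_ler_powR; rewrite ?nnegrE ?energy_ge0 ?(ltW is0)//.
    by apply: sumr_ge0 => k _; exact: energy_ge0.
  by rewrite -(sum_shell_energy x n r0) lerDl energy_ge0.
have bB k : (b k <= B)%R.
  by apply: le_trans (sumb k.+1); rewrite big_ord_recr/= lerDr sumr_ge0.
have radn k := rad_gt0 k r0.
exists (y 0%N); have [xy0 Ey0 gy0] := yP 0%N.
have rad0 : rad r 0 = r by rewrite /rad expr0 mul1r.
have bB0 := bB 0%N; rewrite /b rad0 in bB0.
rewrite rad0 in xy0 gy0.
suff osc : (`|u x - u (y 0%N)| <= chain_const * energy (ball x r) `^ s^-1)%R.
  by split; [exact: xy0|exact: Ey0|exact: le_trans gy0 bB0|exact: osc].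
have step k : (`|u (y k) - u (y k.+1)| <= 2 * b k + 2 / shell_ratio * b k.+1)%R.
  have [xy Ey gy] := yP k; have [xy' Ey' gy'] := yP k.+1.
  apply: (le_trans (ug Ey Ey')).
  have dle : (mdist (y k) (y k.+1) <= 2 * rad r k)%R.
    apply: (le_trans (metric_triangle _ x _)); rewrite metric_sym.
    have radSle : (rad r k.+1 <= rad r k)%R.
      rewrite radS ler_piMl//; [exact: ltW (radn k)|exact: ltW].
    rewrite mulr2n mulrDl mul1r; apply: lerD; first exact: ltW.
    exact: le_trans (ltW xy') radSle.
  apply: (le_trans (ler_wpM2r _ dle)); first by rewrite addr_ge0.
  have -> : (2 * rad r k * (g (y k) + g (y k.+1)) =
      2 * (rad r k * g (y k)) +
      2 / shell_ratio * (rad r k.+1 * g (y k.+1)))%R.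
    by rewrite radS; field; rewrite gt_eqF.
  apply: lerD; apply: ler_wpM2l; [by []|exact: gy| |exact: gy'].
  by rewrite divr_ge0// ltW.
(* [g x] is finite, so the last step is small for a chain that is long enough. *)
apply/ler_addgt0Pl => e e0.
have [n ne] : exists n, (rad r n * g x <= e)%R.
  have [->|gx0] := eqVneq (g x) 0%R; first by exists 0%N; rewrite mulr0 ltW.
  have gxp : (0 < g x)%R by rewrite lt_neqAle eq_sym gx0 g0.
  have : (fun n => shell_ratio ^+ n)%R @ \oo --> 0%R.
    by apply: cvg_expr; rewrite ger0_norm// ltW.
  move=> /cvgrPdist_le/(_ (e / (r * g x))%R).
  rewrite divr_gt0 ?mulr_gt0// => /(_ isT) [n _ /(_ n (leqnn n))/=].
  rewrite sub0r normrN ger0_norm ?exprn_ge0 ?(ltW l0)// => ln.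
  exists n; rewrite /rad -mulrA -ler_pdivlMr ?mulr_gt0//.
have [xyn Eyn gyn] := yP n.
have last_step : (`|u x - u (y n)| <= e + B)%R.
  apply: (le_trans (ug Ex Eyn)).
  apply: (@le_trans _ _ (rad r n * (g x + g (y n)))%R).
    by apply: ler_wpM2r; [rewrite addr_ge0|exact: ltW].
  by rewrite mulrDr; apply: lerD; [exact: ne|exact: le_trans gyn (bB n)].
have tB : (`|u (y 0%N) - u (y n)| <= (2 + 2 / shell_ratio) * B)%R.
  apply: (@chain_bound R (u \o y) b 2 (2 / shell_ratio)%R B n).
  - by [].
  - by rewrite divr_ge0// ltW.
  - exact: step.
  - exact: sumb.
  - exact: b0.
have -> : (u x - u (y 0%N) = (u x - u (y n)) - (u (y 0%N) - u (y n)))%R by ring.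
apply: (le_trans (ler_normB _ _)); apply: (le_trans (lerD last_step tB)).
rewrite /chain_const -mulrA -/B le_eqVlt; apply/orP; left; apply/eqP; ring.
Qed.

(** * Oscillation and uniform continuity off the exceptional set *)

(** Two chains, and one step of length at most [4 rho] between their starting
    points, at each of which [rho g] is controlled. *)
Definition osc_const : R := (2 * chain_const + 8 * shell_const)%R.

Lemma osc_const_gt0 : (0 < osc_const)%R.
Proof.
have K0 : (0 < shell_const)%R by rewrite powR_gt0// mulr_gt0.
rewrite /osc_const /chain_const addr_gt0 ?mulr_gt0//.
by rewrite addr_gt0// divr_gt0// shell_ratio_gt0.
Qed.

(** The balls of radius [rho <= r] around [x] and [y] lie in the ball of radius
    [2 r] around [z], so the chains issued from [x] and [y] are controlled by
    the energy of the latter. *)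
Lemma osc_off_null (x y z : X) r : ~ E x -> ~ E y -> (0 < r)%R ->
  (mdist z x < r)%R -> (mdist z y < r)%R ->
  (`|u x - u y| <= osc_const * energy (ball z (2 * r)%R) `^ s^-1)%R.
Proof.
move=> Ex Ey r0 zx zy.
have [rho [rho0 rhoX rhor rhoab]] := exists_comparable_radius r0 zx zy.
have [x' [xx' Ex' gx' ux']] := osc_center Ex rho0 rhoX.
have [y' [yy' Ey' gy' uy']] := osc_center Ey rho0 rhoX.
have mB w t := @ball_cara_measurable _ _ mu w t mumet.
have le_energy w : (mdist z w < r)%R ->
    (energy (ball w rho) `^ s^-1 <= energy (ball z (2 * r)%R) `^ s^-1)%R.
  move=> zw; apply: ge0_ler_powR; rewrite ?nnegrE; [exact: ltW is0|
    exact: energy_ge0|exact: energy_ge0|].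
  apply: energyS; [exact: mB|exact: mB|move=> v].
  rewrite !ballEmdist/= => wv.
  apply: (le_lt_trans (metric_triangle z w v)).
  by rewrite mulr2n mulrDl mul1r; apply: ltrD => //; exact: lt_le_trans rhor.
have {le_energy} [Jx Jy] := (le_energy _ zx, le_energy _ zy).
set J := (energy (ball z (2 * r)%R) `^ s^-1)%R in Jx Jy *.
have K0 : (0 <= shell_const)%R by exact: powR_ge0.
have cc0 : (0 <= chain_const)%R.
  by rewrite mulr_ge0// addr_ge0// divr_ge0// ltW// shell_ratio_gt0.
have {}gx' := le_trans gx' (ler_wpM2l K0 Jx).
have {}gy' := le_trans gy' (ler_wpM2l K0 Jy).
have {}ux' := le_trans ux' (ler_wpM2l cc0 Jx).
have {}uy' := le_trans uy' (ler_wpM2l cc0 Jy).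
have mid : (`|u x' - u y'| <= 8 * (shell_const * J))%R.
  apply: (le_trans (ug Ex' Ey')).
  apply: (@le_trans _ _ (4 * (rho * g x') + 4 * (rho * g y'))%R).
    rewrite !mulrA -mulrDr; apply: ler_wpM2r; first by rewrite addr_ge0.
    exact: rhoab.
  have -> : (8 * (shell_const * J) =
      4 * (shell_const * J) + 4 * (shell_const * J))%R by ring.
  by apply: lerD; apply: ler_wpM2l; [by []|exact: gx'|by []|exact: gy'].
have -> : (u x - u y = (u x - u x') + (u x' - u y') - (u y - u y'))%R by ring.
apply: (le_trans (ler_normB _ _)).
apply: (le_trans (lerD (ler_normD _ _) uy')).
apply: (le_trans (lerD (lerD ux' mid) (lexx _))).
rewrite le_eqVlt; apply/orP; left; apply/eqP; rewrite /osc_const; ring.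
Qed.

(** Two points at distance less than [t / 2] lie in a ball of radius [t / 2],
    so their values differ by at most the power of the energy of a ball of
    radius [t].  The measure of that ball is at most [C t^s], whatever
    its centre; absolute continuity of the integral makes its energy small. *)
Lemma unif_continuous_off_null (e : R) : (0 < e)%R ->
  exists2 d : R, (0 < d)%R &
    forall x y, ~ E x -> ~ E y -> (mdist x y < d)%R -> (`|u x - u y| < e)%R.
Proof.
move=> e0; have c0 := osc_const_gt0.
(* the energy below which the oscillation estimate gives less than [e] *)
have eta0 : (0 < (e / osc_const) `^ s)%R by rewrite powR_gt0// divr_gt0.
have [d0 [d00 small]] := integral_normr_continuous ig eta0.
have [r r0 rX] := exists_radius.
pose t := Num.min r ((d0 / (2 * C)) `^ s^-1)%R.
have t0 : (0 < t)%R by rewrite lt_min r0 powR_gt0// divr_gt0// mulr_gt0.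
have tX : t%:E < diam [set: X].
  by apply: le_lt_trans rX; rewrite lee_fin ge_min lexx.
exists (t / 2)%R; first by rewrite divr_gt0.
move=> x y Ex Ey xy.
have th0 : (0 < t / 2)%R by rewrite divr_gt0.
have xx : (mdist x x < t / 2)%R by rewrite mdistxx.
apply: (le_lt_trans (osc_off_null Ex Ey th0 xx xy)).
have -> : (2 * (t / 2) = t)%R by field.
rewrite mulrC -ltr_pdivlMr//.
have -> : (e / osc_const = ((e / osc_const) `^ s) `^ s^-1)%R.
  by rewrite -powRrM mulfV ?gt_eqF// powRr1// ltW// divr_gt0.
apply: gt0_ltr_powR; rewrite ?nnegrE; [exact: is0|exact: energy_ge0|exact: ltW|].
have mB := @ball_cara_measurable _ _ mu x t mumet.
have -> : energy (ball x t) = (\int[cara_measure mu]_(x in ball x t) `|g x `^ s|)%R.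
  by apply: eq_Rintegral => w _; rewrite ger0_norm// powR_ge0.
apply: small => //.
have /andP[_ up] := reg x t0 tX.
apply: (le_lt_trans up); rewrite lte_fin mulrC -ltr_pdivlMr//.
have : (t `^ s <= ((d0 / (2 * C)) `^ s^-1) `^ s)%R.
  apply: ge0_ler_powR; rewrite ?nnegrE ?powR_ge0 ?(ltW s0) ?(ltW t0)//.
  by rewrite ge_min lexx orbT.
move=> /le_lt_trans; apply.
rewrite -powRrM mulVf ?gt_eqF// powRr1; last by rewrite ltW// divr_gt0// mulr_gt0.
by rewrite ltr_pM2l// ltf_pV2 ?posrE ?mulr_gt0//; move: C0; lra.
Qed.

End ahlfors.

(** * Extension from a dense set *)

(** The extension at [x] is the limit of [u] along the trace on [D] of the
    neighbourhoods of [x], a Cauchy filter by uniform continuity. *)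
Lemma unif_continuous_extension (R : realType) (X : metricType R) (D : set X)
    (u : X -> R) :
  (forall x (e : R), (0 < e)%R -> exists2 y, (mdist x y < e)%R & D y) ->
  (forall e : R, (0 < e)%R -> exists2 d : R, (0 < d)%R &
    forall x y, D x -> D y -> (mdist x y < d)%R -> (`|u x - u y| < e)%R) ->
  exists2 ut : X -> R, unif_continuous ut & forall x, D x -> ut x = u x.
Proof.
move=> Ddense ucu.
have lim_ex x : exists l : R, forall e : R, (0 < e)%R ->
    exists2 d : R, (0 < d)%R & forall y, D y -> (mdist x y < d)%R -> (`|l - u y| <= e)%R.
  have FF : ProperFilter (within D (nbhs x)).
    apply: within_nbhs_proper => B; rewrite -nbhs_ballE => -[d /= d0 dB].
    have [y xy Dy] := Ddense x d d0; exists y; split => //; apply: dB.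
    by rewrite /= ballEmdist.
  have near_pt (d : R) : (0 < d)%R ->
      within D (nbhs x) [set y | D y /\ (mdist x y < d)%R].
    move=> d0; rewrite /within/=; near=> y => Dy; split => //.
    suff : ball x d y by rewrite ballEmdist.
    by near: y; exact: nbhsx_ballx.
  have : cvg (u @ within D (nbhs x)).
    apply/cauchy_cvgP/cauchy_exP => e e0.
    have [d d0 du] := ucu e e0.
    have d20 : (0 < d / 2)%R by rewrite divr_gt0.
    have [y xy Dy] := Ddense x _ d20; exists (u y).
    apply: filterS (near_pt _ d20) => w [Dw xw]; apply: du => //.
    apply: (le_lt_trans (metric_triangle _ x _)); rewrite metric_sym.
    by rewrite (splitr d) ltrD.
  move=> /cvg_ex[/= l ul]; exists l => e e0.
  have e20 : (0 < e / 2)%R by rewrite divr_gt0.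
  have [d d0 du] := ucu _ e20.
  have d20 : (0 < d / 2)%R by rewrite divr_gt0.
  exists (d / 2)%R => // y Dy xy.
  have ul2 := iffLR (@cvgrPdist_lt _ _ _ _ FF u l) ul _ e20.
  have [w [uw [Dw xw]]] :=
    @filter_ex _ _ FF _ (@filterI _ _ FF _ _ ul2 (near_pt _ d20)).
  rewrite -(subrKA (u w)) (splitr e); apply: (le_trans (ler_normD _ _)).
  apply: lerD; first exact: ltW.
  apply/ltW/du => //; apply: (le_lt_trans (metric_triangle _ x _)).
  by rewrite metric_sym (splitr d) ltrD.
have [ut utP] := choice lim_ex.
have utD x : D x -> ut x = u x.
  move=> Dx; apply/eqP; rewrite -subr_eq0 -normr_le0; apply/ler_addgt0Pl => e e0.
  have [d d0 ud] := utP x e e0; rewrite addr0; apply: ud => //.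
  by rewrite mdistxx.
exists ut => //; apply/unif_continuousP => e e0.
have e40 : (0 < e / 4)%R by rewrite divr_gt0.
have [d d0 ud] := ucu _ e40.
exists (d / 3)%R; first by rewrite divr_gt0.
move=> [x y] /=; rewrite ballEmdist/= => xy.
have d30 : (0 < d / 3)%R by rewrite divr_gt0.
have near_val v : exists w, [/\ D w, (mdist v w < d / 3)%R & (`|ut v - u w| <= e / 4)%R].
  have [dv dv0 vP] := utP v _ e40.
  have m0 : (0 < Num.min dv (d / 3))%R by rewrite lt_min dv0.
  have [w + Dw] := Ddense v _ m0; rewrite lt_min => /andP[vw1 vw2].
  by exists w; split => //; exact: vP.
have [x' [Dx' xx' ux']] := near_val x; have [y' [Dy' yy' uy']] := near_val y.
have : (`|u x' - u y'| < e / 4)%R.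
  apply: ud => //; have := metric_triangle x' x y'; have := metric_triangle x y y'.
  by rewrite (metric_sym x' x); move: xx' yy' xy; lra.
rewrite /ball/= => u'.
have -> : (ut x - ut y = (ut x - u x') + (u x' - u y') - (ut y - u y'))%R by ring.
apply: (le_lt_trans (ler_normB _ _)).
have := ler_normD (ut x - u x')%R (u x' - u y')%R.
by move: u' ux' uy' e0; lra.
Unshelve. all: by end_near. Qed.

(** Oscillation bounds over open balls may be checked on a dense set; this lets
    every gradient come with its own exceptional set. *)
Lemma dense_osc_le (R : realType) (X : metricType R) (D : set X) (v : X -> R)
    (z : X) (r B : R) :
  unif_continuous v ->
  (forall x (e : R), (0 < e)%R -> exists2 y, (mdist x y < e)%R & D y) ->
  (forall x y, D x -> D y -> (mdist z x < r)%R -> (mdist z y < r)%R ->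
    (`|v x - v y| <= B)%R) ->
  forall x y, (mdist z x < r)%R -> (mdist z y < r)%R -> (`|v x - v y| <= B)%R.
Proof.
move=> /unif_continuousP ucv Ddense oscD x y zx zy.
apply/ler_addgt0Pl => e e0.
have e20 : (0 < e / 2)%R by rewrite divr_gt0.
have [d d0 dv] := ucv _ e20.
have near_pt w : (mdist z w < r)%R ->
    exists w', [/\ D w', (mdist z w' < r)%R & (`|v w - v w'| < e / 2)%R].
  move=> zw.
  have m0 : (0 < Num.min d (r - mdist z w))%R by rewrite lt_min d0 subr_gt0.
  have [w' + Dw'] := Ddense w _ m0; rewrite lt_min => /andP[ww' ww'r].
  exists w'; split => //.
    by apply: (le_lt_trans (metric_triangle _ w _)); rewrite -ltrBrDl.
  have := dv (w, w'); rewrite /= ballEmdist => /(_ ww').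
  by rewrite /ball/=.
have [x' [Dx' zx' xx']] := near_pt x zx; have [y' [Dy' zy' yy']] := near_pt y zy.
have := oscD _ _ Dx' Dy' zx' zy'.
have -> : (v x - v y = (v x - v x') + (v x' - v y') - (v y - v y'))%R by ring.
move=> oB; apply: (le_trans (ler_normB _ _)).
have := ler_normD (v x - v x')%R (v x' - v y')%R.
by move: xx' yy' oB; lra.
Qed.

(** * The estimate for the continuous representative *)

Lemma in_Lp_integrable (R : realType) (X : pointedMetricType R)
    (mu : {outer_measure set X -> \bar R}) (s : R) (g : X -> R) :
  (0 < s)%R -> (forall x, (0 <= g x)%R) -> in_Lp mu s g ->
  (cara_measure mu).-integrable setT (EFin \o (fun x => g x `^ s)%R).
Proof.
move=> s0 g0 [mg Lg]; apply/integrableP; split.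
  apply/measurable_EFinP.
  exact: (measurableT_comp (measurable_powR s) mg).
move: Lg; rewrite /finite_norm => Lg.
have := poweR_lty s Lg; rewrite poweR_Lnorm ?gt_eqF//.
congr (_ < _); apply: eq_integral => x _ /=.
by rewrite !ger0_norm ?powR_ge0// poweR_EFin.
Qed.

Theorem theorem1 (R : realType) (X : pointedMetricType R) (s : R)
    (s_gt0 : (0 < s)%R) (s_le1 : (s <= 1)%R)
    (regX : @ahlfors_regular R X s (hausdorff s)) :
  exists2 C : R, (0 < C)%R &
    forall u : X -> R, hajlasz_sobolev (hausdorff s) s u ->
      exists ut : X -> R,
        [/\ unif_continuous ut,
            {ae cara_measure (hausdorff s), forall x, ut x = u x} &
            forall (z : X) (r : R) (g : X -> R), (0 < r)%R ->
              hajlasz_gradient (hausdorff s) u g -> in_Lp (hausdorff s) s g ->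
              ereal_sup [set `|ut x - ut y|%:E | x in ball z r & y in ball z r]
              <= C%:E * (\int[cara_measure (hausdorff s)]_(x in ball z (2 * r))
                           (g x `^ s)%:E) `^ s^-1].
Proof.
have [C C1 reg] := regX; have met := @hausdorff_metric_outer_measure R X s.
have [X0|X0] := ltP 0 (diam [set: X]); last first.
  (* a space of diameter 0 is a single point *)
  have eqX (x y : X) : x = y.
    apply: mdist_positivity; apply/eqP; rewrite eq_le mdist_ge0 andbT -lee_fin.
    exact: le_trans (@mdist_le_diam _ X setT x y I I) X0.
  exists 1%R => // u _; exists u; split.
  - apply/unif_continuousP => e e0; exists 1%R => // -[x y] _ /=.
    by rewrite (eqX x y); exact: ballxx.
  - exact: aeW.
  - move=> z r g r0 _ _; apply: ge_ereal_sup => _ [x _ [y _ <-]].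
    by rewrite (eqX x y) subrr normr0 mul1e poweR_ge0.
have dense (N : set X) : hausdorff s N = 0 -> forall x (e : R), (0 < e)%R ->
    exists2 y, (mdist x y < e)%R & ~ N y.
  by move=> N0; exact: (off_null_dense C1 reg X0 N0).
exists (osc_const s C); first exact: osc_const_gt0.
move=> u [_ [g0 [g00 _ [E0 E00 ug0]] Lp0]].
have ig0 := in_Lp_integrable s_gt0 g00 Lp0.
have [ut ucut utE] := unif_continuous_extension (dense _ E00)
  (unif_continuous_off_null met s_gt0 C1 reg X0 s_le1 g00 E00 ug0 ig0).
exists ut; split => //.
  exists E0; split => //; first exact: null_measurable.
  by move=> x /= utu; apply: contrapT => /utE.
move=> z r g r0 [gge0 _ [E E_0 ug]] Lpg.
have ig := in_Lp_integrable s_gt0 gge0 Lpg.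
pose N := E `|` E0.
have N0 : hausdorff s N = 0.
  apply/eqP; rewrite eq_le hausdorff_ge0 andbT.
  apply: (le_trans (outer_measureU2 (hausdorff s) E E0)).
  by rewrite /= E_0 E00 adde0.
have mB := @ball_cara_measurable _ _ (hausdorff s) z (2 * r)%R met.
rewrite (energyE ig mB) poweR_EFin -EFinM.
apply: ge_ereal_sup => _ [x zx [y zy <-]]; rewrite lee_fin.
rewrite !ballEmdist/= in zx zy.
apply: (dense_osc_le ucut (dense _ N0) _ zx zy) => {zx zy} {}x {}y Nx Ny zx zy.
have [Ex Ex0] : ~ E x /\ ~ E0 x by split=> ?; apply: Nx; [left|right].
have [Ey Ey0] : ~ E y /\ ~ E0 y by split=> ?; apply: Ny; [left|right].
rewrite !utE//.
exact: (osc_off_null met s_gt0 C1 reg X0 s_le1 gge0 E_0 ug ig Ex Ey r0 zx zy).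
Qed.
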